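(* Let $\mathfrak g=\mathfrak{sl}(2)$, let $\theta$ be the involution of $\mathfrak g$ with $\theta(H)=H$, $\theta(E^\pm)=-E^\pm$, so that the $\theta$-fixed subalgebra $\theta(\mathfrak g)$ is spanned by $H$, and let $\bar\theta$ be the involution of $\mathcal{Y}(\mathfrak g)$ extending $\theta$ with $\bar\theta(\widehat H)=-\widehat H$, $\bar\theta(\widehat E^\pm)=\widehat E^\pm$, $\bar\theta(\alpha)=-\alpha$. Then the twisted Yangian $\mathcal{Y}(\mathfrak g,\theta(\mathfrak g))$ of type I is the $\bar\theta$-fixed coideal subalgebra of $\mathcal{Y}(\mathfrak g)$ generated by the Cartan generator $H$ and the twisted Yangian generators $$\widetilde E^\pm=\widehat E^\pm\pm\alpha\,t\,E^\pm\pm\frac{\alpha}{4}(E^\pm H+HE^\pm),$$ where $t\in\mathbb{C}$ is an arbitrary complex number.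
   Context: $\mathcal{Y}(\mathfrak{sl}(2))$ is the Yangian (Drinfeld's first realization), where $\alpha$ is a formal level-one deformation parameter. It is generated by the level-zero generators $E^\pm,H$ and level-one generators $\widehat E^\pm,\widehat H$, with $[H,E^\pm]=\pm2E^\pm$, $[E^+,E^-]=H$, $[H,\widehat E^\pm]=\pm2\widehat E^\pm$, $[E^\pm,\widehat E^\mp]=\pm\widehat H$, $[H,\widehat H]=0$ (more generally, level-one generators transform in the adjoint representation of the level-zero ones), and Drinfeld's Serre-type relation for $\mathfrak{sl}(2)$, whose right-hand side is proportional to $\alpha^2$. Coproduct: $\Delta(x)=x\otimes1+1\otimes x$ for $x\in\{E^\pm,H\}$, $$\Delta(\widehat H)=\widehat H\otimes1+1\otimes\widehat H-\alpha(E^+\otimes E^--E^-\otimes E^+),$$ $$\Delta(\widehat E^\pm)=\widehat E^\pm\otimes1+1\otimes\widehat E^\pm\pm\frac{\alpha}{2}(E^\pm\otimes H-H\otimes E^\pm).$$ ''Coideal'' means left coideal: $\Delta(b)\in\mathcal{Y}(\mathfrak g)\otimes\mathcal B$ for all $b$ in the subalgebra $\mathcal B$. Twisted Yangian of type I in general: for a Lie algebra $\mathfrak g$ with a nontrivial involution $\theta$, let $\mathfrak g=\mathfrak h\oplus\mathfrak m$ be the splitting into the $\theta$-fixed subalgebra $\mathfrak h=\theta(\mathfrak g)$ and the $(-1)$-eigenspace $\mathfrak m$, and extend $\theta$ to $\bar\theta$ on $\mathcal Y(\mathfrak g)$ by $\bar\theta(\widehat j^{\,i})=-\widehat j^{\,i}$,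 $\bar\theta(\widehat j^{\,p})=\widehat j^{\,p}$, $\bar\theta(\alpha)=-\alpha$, with $i$ running over $\mathfrak h$-indices and $p,q$ over $\mathfrak m$-indices. The involution $\bar\theta$, combined with the requirement that the $\bar\theta$-fixed subalgebra satisfy the left coideal property, defines the twisted Yangian $\mathcal Y(\mathfrak g,\mathfrak h)$. It is the left coideal subalgebra of $\mathcal Y(\mathfrak g)$ generated by the level-zero generators $j^i$ and the twisted level-one generators $\widetilde j^{\,p}=\widehat j^{\,p}+\alpha\,t\,j^p+\frac{\alpha}{4}f^p{}_{qi}(j^qj^i+j^ij^q)$, where $f$ are the structure constants and $t\in\mathbb C$ is arbitrary.
   Formalization: The general definition of the twisted Yangian uses one coefficient t for all j^p, which disagrees with ±t here unless t=0; the linear coefficient is therefore allowed to depend on p and is taken as t for E^+ and -t for E^-. *)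

(* Defs.v *)
From HB Require Import structures.
From mathcomp Require Import all_boot all_order all_algebra.
From mathcomp Require Import boolp classical_sets reals complex.

Set Implicit Arguments.
Unset Strict Implicit.
Unset Printing Implicit Defensive.

Import GRing.Theory.
Local Open Scope ring_scope.

Inductive term (C G : Type) : Type :=
| TConst of C
| TGen of G
| TAdd of term C G & term C G
| TMul of term C G & term C G.

Arguments TConst {C G}.
Arguments TGen {C G}.

Fixpoint teval (C : fieldType) (G : Type) (A : algType C) (g : G -> A)
    (x : term C G) : A :=
  match x with
  | TConst c => c%:A
  | TGen i => g i
  | TAdd x y => teval g x + teval g y
  | TMul x y => teval g x * teval g y
  end.

Declare Scope nalg_scope.
Delimit Scope nalg_scope with A.
Bind Scope nalg_scope with term.
Notation "x + y" := (TAdd x%A y%A) : nalg_scope.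
Notation "x * y" := (TMul x%A y%A) : nalg_scope.
Notation "c *: x" := (TMul (TConst c%R) x%A) : nalg_scope.
Notation "x - y" := (TAdd x%A (TMul (TConst (- 1)%R) y%A)) : nalg_scope.
Notation "[ 'br' x , y ]" := (TAdd (TMul x%A y%A)
  (TMul (TConst (- 1)%R) (TMul y%A x%A))) (at level 0) : nalg_scope.

(* MathComp algebras are nonzero, so a presentation comes with an augmentation
   (a point in the base field), which witnesses 1 != 0 in the quotient. It plays
   no role in the algebra that is presented. *)
Record presentation (C : fieldType) := Presentation {
  pgen : Type;
  prel : term C pgen -> term C pgen -> Prop;
  paug : pgen -> C^o;
  paug_rel : forall x y, prel x y -> teval paug x = teval paug y
}.

Section PresentedAlgebra.
Variables (C : fieldType) (P : presentation C).
Local Notation tm := (term C (pgen P)).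

Inductive cong : tm -> tm -> Prop :=
| cong_rel x y : prel x y -> cong x y
| cong_refl x : cong x x
| cong_sym x y : cong x y -> cong y x
| cong_trans x y z : cong x y -> cong y z -> cong x z
| cong_add x x' y y' : cong x x' -> cong y y' -> cong (x + y)%A (x' + y')%A
| cong_mul x x' y y' : cong x x' -> cong y y' -> cong (x * y)%A (x' * y')%A
| cong_addA x y z : cong (x + (y + z))%A (x + y + z)%A
| cong_addC x y : cong (x + y)%A (y + x)%A
| cong_add0 x : cong (TConst 0 + x)%A x
| cong_addN x : cong ((- 1) *: x + x)%A (TConst 0)
| cong_mulA x y z : cong (x * (y * z))%A (x * y * z)%A
| cong_mul1l x : cong (1 *: x)%A x
| cong_mul1r x : cong (x * TConst 1)%A x
| cong_mulDl x y z : cong ((x + y) * z)%A (x * z + y * z)%A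
| cong_mulDr x y z : cong (x * (y + z))%A (x * y + x * z)%A
| cong_constD a b : cong (TConst (a + b)) (TConst a + TConst b)%A
| cong_constM a b : cong (TConst (a * b)) (TConst a * TConst b)%A
| cong_constC a x : cong (a *: x)%A (x * TConst a)%A.

Lemma teval_cong (A : algType C) (g : pgen P -> A) :
  (forall x y, prel x y -> teval g x = teval g y) ->
  forall x y, cong x y -> teval g x = teval g y.
Proof.
move=> hg x y; elim=> {x y} //=.
- by move=> x y z _ -> _ ->.
- by move=> x x' y y' _ -> _ ->.
- by move=> x x' y y' _ -> _ ->.
- by move=> *; rewrite addrA.
- by move=> *; rewrite addrC.
- by move=> *; rewrite scale0r add0r.
- by move=> *; rewrite scaleN1r mulN1r addNr scale0r.
- by move=> *; rewrite mulrA.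
- by move=> *; rewrite scale1r mul1r.
- by move=> *; rewrite scale1r mulr1.
- by move=> *; rewrite mulrDl.
- by move=> *; rewrite mulrDr.
- by move=> *; rewrite scalerDl.
- by move=> a b; rewrite -scalerAl mul1r scalerA.
- by move=> a x; rewrite -scalerAl -scalerAr mul1r mulr1.
Qed.

Definition congb (x y : {classic tm}) : bool := `[< cong x y >].

Lemma congb_refl : reflexive congb.
Proof. by move=> x; apply/asboolP; apply: cong_refl. Qed.

Lemma congb_sym : symmetric congb.
Proof. by move=> x y; apply/asboolP/asboolP; apply: cong_sym. Qed.

Lemma congb_trans : transitive congb.
Proof.
move=> y x z /asboolP xy /asboolP yz; apply/asboolP; exact: cong_trans xy yz.
Qed.

Canonical congb_equiv := EquivRel congb congb_refl congb_sym congb_trans.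

Local Open Scope quotient_scope.

Definition palg := {eq_quot congb_equiv}.
HB.instance Definition _ := Choice.on palg.
HB.instance Definition _ := EqQuotient.on palg.

Definition pcls (x : tm) : palg := \pi_palg (x : {classic tm}).

Lemma pclsP x y : pcls x = pcls y <-> cong x y.
Proof.
split; first by move/eqmodP/asboolP.
by move=> xy; apply/eqmodP/asboolP.
Qed.

Lemma pcls_repr (u : palg) : pcls (repr u) = u.
Proof. exact: reprK. Qed.

Lemma palg_ind (Q : palg -> Prop) : (forall x, Q (pcls x)) -> forall u, Q u.
Proof. by move=> h u; rewrite -(pcls_repr u). Qed.

Lemma cong_repr x : cong (repr (pcls x)) x.
Proof. by apply/pclsP; rewrite pcls_repr. Qed.

Definition padd (u v : palg) : palg := pcls (repr u + repr v)%A.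
Definition pmul (u v : palg) : palg := pcls (repr u * repr v)%A.
Definition popp (u : palg) : palg := pcls ((- 1) *: (repr u : tm))%A.
Definition pscale (a : C) (u : palg) : palg := pcls (a *: (repr u : tm))%A.

Lemma paddE x y : padd (pcls x) (pcls y) = pcls (x + y)%A.
Proof. by apply/pclsP; apply: cong_add; apply: cong_repr. Qed.
Lemma pmulE x y : pmul (pcls x) (pcls y) = pcls (x * y)%A.
Proof. by apply/pclsP; apply: cong_mul; apply: cong_repr. Qed.
Lemma poppE x : popp (pcls x) = pcls ((- 1) *: x)%A.
Proof.
by apply/pclsP; apply: cong_mul; [apply: cong_refl | apply: cong_repr].
Qed.
Lemma pscaleE a x : pscale a (pcls x) = pcls (a *: x)%A.
Proof.
by apply/pclsP; apply: cong_mul; [apply: cong_refl | apply: cong_repr].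
Qed.

Lemma paddA : associative padd.
Proof.
elim/palg_ind=> x; elim/palg_ind=> y; elim/palg_ind=> z.
by rewrite !paddE; apply/pclsP; apply: cong_addA.
Qed.
Lemma paddC : commutative padd.
Proof.
elim/palg_ind=> x; elim/palg_ind=> y.
by rewrite !paddE; apply/pclsP; apply: cong_addC.
Qed.
Lemma padd0 : left_id (pcls (TConst 0)) padd.
Proof.
by elim/palg_ind=> x; rewrite !paddE; apply/pclsP; apply: cong_add0.
Qed.
Lemma paddN : left_inverse (pcls (TConst 0)) popp padd.
Proof.
by elim/palg_ind=> x; rewrite poppE paddE; apply/pclsP; apply: cong_addN.
Qed.

HB.instance Definition _ := GRing.isZmodule.Build palg paddA paddC padd0 paddN.

Lemma pclsD x y : pcls x + pcls y = pcls (x + y)%A.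
Proof. exact: paddE. Qed.

Lemma pmulA : associative pmul.
Proof.
elim/palg_ind=> x; elim/palg_ind=> y; elim/palg_ind=> z.
by rewrite !pmulE; apply/pclsP; apply: cong_mulA.
Qed.
Lemma pmul1l : left_id (pcls (TConst 1)) pmul.
Proof.
by elim/palg_ind=> x; rewrite !pmulE; apply/pclsP; apply: cong_mul1l.
Qed.
Lemma pmul1r : right_id (pcls (TConst 1)) pmul.
Proof.
by elim/palg_ind=> x; rewrite !pmulE; apply/pclsP; apply: cong_mul1r.
Qed.
Lemma pmulDl : left_distributive pmul +%R.
Proof.
elim/palg_ind=> x; elim/palg_ind=> y; elim/palg_ind=> z.
rewrite pclsD !pmulE pclsD.
by apply/pclsP; apply: cong_mulDl.
Qed.
Lemma pmulDr : right_distributive pmul +%R.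
Proof.
elim/palg_ind=> x; elim/palg_ind=> y; elim/palg_ind=> z.
rewrite pclsD !pmulE pclsD.
by apply/pclsP; apply: cong_mulDr.
Qed.
Lemma pone_neq0 : pcls (TConst 1) != 0.
Proof.
apply/eqP => /pclsP /(teval_cong (@paug_rel _ P)) /=.
by rewrite scale0r scale1r => /eqP; rewrite oner_eq0.
Qed.

HB.instance Definition _ := GRing.Zmodule_isNzRing.Build palg
  pmulA pmul1l pmul1r pmulDl pmulDr pone_neq0.

Lemma pclsM x y : pcls x * pcls y = pcls (x * y)%A.
Proof. exact: pmulE. Qed.

Lemma pscaleA a b u : pscale a (pscale b u) = pscale (a * b) u.
Proof.
elim/palg_ind: u => x; rewrite !pscaleE; apply/pclsP.
apply: cong_trans (cong_mulA _ _ _) _.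
by apply: cong_mul; [apply/cong_sym/cong_constM | apply: cong_refl].
Qed.
Lemma pscale1 : left_id 1 pscale.
Proof.
by elim/palg_ind=> x; rewrite !pscaleE; apply/pclsP; apply: cong_mul1l.
Qed.
Lemma pscaleDr : right_distributive pscale +%R.
Proof.
move=> a; elim/palg_ind=> x; elim/palg_ind=> y.
rewrite pclsD !pscaleE pclsD.
by apply/pclsP; apply: cong_mulDr.
Qed.
Lemma pscaleDl u : {morph pscale^~ u : a b / a + b}.
Proof.
move=> a b /=; elim/palg_ind: u => x.
rewrite !pscaleE pclsD; apply/pclsP.
apply: cong_trans (cong_mulDl _ _ _).
by apply: cong_mul; [apply: cong_constD | apply: cong_refl].
Qed.

HB.instance Definition _ := GRing.Zmodule_isLmodule.Build C palg
  pscaleA pscale1 pscaleDr pscaleDl.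

Lemma pclsZ a x : a *: pcls x = pcls (a *: x)%A.
Proof. exact: pscaleE. Qed.

Lemma pscaleAl (a : C) (u v : palg) : a *: (u * v) = a *: u * v.
Proof.
elim/palg_ind: u => x; elim/palg_ind: v => y.
rewrite pclsM !pclsZ pclsM.
by apply/pclsP; apply: cong_mulA.
Qed.

HB.instance Definition _ := GRing.Lmodule_isLalgebra.Build C palg pscaleAl.

Lemma pscaleAr (a : C) (u v : palg) : a *: (u * v) = u * (a *: v).
Proof.
elim/palg_ind: u => x; elim/palg_ind: v => y.
rewrite pclsM !pclsZ pclsM; apply/pclsP.
apply: cong_trans (cong_mulA _ _ _) _.
apply: cong_trans (cong_mul (cong_constC _ _) (cong_refl _)) _.
exact/cong_sym/cong_mulA.
Qed.

HB.instance Definition _ := GRing.Lalgebra_isAlgebra.Build C palg pscaleAr.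

Definition pgenerator (i : pgen P) : palg := pcls (TGen i).

Section Lift.
Variables (A : algType C) (g : pgen P -> A).
Hypothesis g_rel : forall x y, prel x y -> teval g x = teval g y.

Definition plift of (forall x y, prel x y -> teval g x = teval g y) :=
  fun u : palg => teval g (repr u : tm).
Local Notation lift := (plift g_rel).

Lemma pliftE x : lift (pcls x) = teval g x.
Proof. exact: (teval_cong g_rel (cong_repr x)). Qed.

Lemma plift_gen i : lift (pgenerator i) = g i.
Proof. exact: pliftE. Qed.

Lemma plift_is_linear : linear lift.
Proof.
move=> a; elim/palg_ind=> x; elim/palg_ind=> y.
rewrite pclsZ pclsD !pliftE /=.
by rewrite -scalerAl mul1r.
Qed.

Lemma plift_is_monoid_morphism : monoid_morphism lift.
Proof.
split; first by rewrite [LHS]pliftE /= scale1r.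
elim/palg_ind=> x; elim/palg_ind=> y.
by rewrite pclsM !pliftE.
Qed.

HB.instance Definition _ := GRing.isLinear.Build C palg A *:%R lift
  plift_is_linear.
HB.instance Definition _ := GRing.isMonoidMorphism.Build palg A lift
  plift_is_monoid_morphism.
End Lift.

End PresentedAlgebra.

(* For z central in A, the algebra generated by two commuting copies of A in
   which the two copies of z coincide is A (x)_(C[z]) A. *)
Section TensorSquare.
Variables (C : fieldType) (A : algType C) (z : A) (eps : {lrmorphism A -> C^o}).
Local Notation l x := (TGen (inl x) : term C (A + A)).
Local Notation r x := (TGen (inr x) : term C (A + A)).

Inductive tens_rel : term C (A + A) -> term C (A + A) -> Prop :=
| tens_linl (a : C) (x y : A) : tens_rel (l (a *: x + y)) (a *: l x + l y)%A
| tens_linr (a : C) (x y : A) : tens_rel (r (a *: x + y)) (a *: r x + r y)%A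
| tens_mull (x y : A) : tens_rel (l (x * y)) (l x * l y)%A
| tens_mulr (x y : A) : tens_rel (r (x * y)) (r x * r y)%A
| tens_1l : tens_rel (l 1) (TConst 1)
| tens_1r : tens_rel (r 1) (TConst 1)
| tens_comm (x y : A) : tens_rel (l x * r y)%A (r y * l x)%A
| tens_balanced : tens_rel (l z) (r z).

Definition tens_aug (u : A + A) : C^o :=
  match u with inl x => eps x | inr x => eps x end.

Lemma tens_aug_rel x y : tens_rel x y -> teval tens_aug x = teval tens_aug y.
Proof.
case=> {x y} //=.
- by move=> a x y; rewrite linearP -scalerAl mul1r.
- by move=> a x y; rewrite linearP -scalerAl mul1r.
- by move=> x y; rewrite rmorphM.
- by move=> x y; rewrite rmorphM.
- by rewrite rmorph1 scale1r.
- by rewrite rmorph1 scale1r.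
- by move=> x y; rewrite [RHS](@mulrC C).
Qed.

Definition tens_presentation := Presentation tens_aug_rel.
Definition tens2 : algType C := palg tens_presentation.
Definition ptens (x y : A) : tens2 :=
  pgenerator (inl x : pgen tens_presentation) *
  pgenerator (inr y : pgen tens_presentation).
End TensorSquare.

(* [true] is the sign +, [false] the sign -. *)
Variant sl2_index : Type := iE of bool | iH.

Definition sl2_index_code (a : sl2_index) : option bool :=
  if a is iE s then Some s else None.
Definition sl2_index_decode (b : option bool) : sl2_index :=
  if b is Some s then iE s else iH.
Lemma sl2_index_codeK : cancel sl2_index_code sl2_index_decode.
Proof. by case. Qed.
HB.instance Definition _ := Finite.copy sl2_index (can_type sl2_index_codeK).

Section Yangian.
Variable C : fieldType.

Definition pm (s : bool) : C := if s then 1 else -1.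

Definition sl2 (a : sl2_index) : 'M[C]_2 :=
  match a with
  | iE true => delta_mx 0 1
  | iE false => delta_mx 1 0
  | iH => delta_mx 0 0 - delta_mx 1 1
  end.

(* The basis dual to [sl2] for the trace form (x, y) |-> \tr (x * y). *)
Definition sl2_dual (a : sl2_index) : 'M[C]_2 :=
  match a with
  | iE s => sl2 (iE (~~ s))
  | iH => 2%:R^-1 *: sl2 iH
  end.

(* f^a_(bc), the two lower indices being lowered with the trace form; with this
   normalization the level-one coproduct of the Yangian reads
   x (x) 1 + 1 (x) x + alpha/2 f^a_(bc) j^b (x) j^c. *)
Definition sl2_struct (a b c : sl2_index) : C :=
  \tr ((sl2 a *m sl2_dual b - sl2_dual b *m sl2 a) *m sl2_dual c).

(* alpha is a central generator rather than a scalar, since the extended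
   involution changes its sign. *)
Variant yangian_gen : Type :=
| Level0 of sl2_index
| Level1 of sl2_index
| Alpha.

Local Notation tE s := (TGen (Level0 (iE s)) : term C yangian_gen).
Local Notation tH := (TGen (Level0 iH) : term C yangian_gen).
Local Notation tEh s := (TGen (Level1 (iE s)) : term C yangian_gen).
Local Notation tHh := (TGen (Level1 iH) : term C yangian_gen).
Local Notation tal := (TGen Alpha : term C yangian_gen).

(* The coefficient alpha^2 of the Serre relation is the one compatible with the
   coproduct below. *)
Inductive yangian_rel : term C yangian_gen -> term C yangian_gen -> Prop :=
| yrel_alpha g : yangian_rel (tal * TGen g)%A (TGen g * tal)%A
| yrel_HE s : yangian_rel [br tH, tE s]%A (pm s * 2%:R *: tE s)%A
| yrel_EE : yangian_rel [br tE true, tE false]%A tH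
| yrel_HEh s : yangian_rel [br tH, tEh s]%A (pm s * 2%:R *: tEh s)%A
| yrel_EHh s : yangian_rel [br tE s, tHh]%A (- pm s * 2%:R *: tEh s)%A
| yrel_EEh s : yangian_rel [br tE s, tEh (~~ s)]%A (pm s *: tHh)%A
| yrel_EEh0 s : yangian_rel [br tE s, tEh s]%A (TConst 0)
| yrel_HHh : yangian_rel [br tH, tHh]%A (TConst 0)
| yrel_serre : yangian_rel [br tHh, [br tEh true, tEh false]]%A
    (tal * tal * ((tEh false * tE true - tE false * tEh true) * tH))%A.

Definition yangian_aug (g : yangian_gen) : C^o := 0.

Lemma yangian_aug_rel x y :
  yangian_rel x y -> teval yangian_aug x = teval yangian_aug y.
Proof.
by case=> {x y} * /=; rewrite /yangian_aug ?(mul0r, mulr0, addr0, scale0r).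
Qed.

Definition yangian_presentation := Presentation yangian_aug_rel.
Definition yangian : algType C := palg yangian_presentation.

Definition ygen (g : yangian_gen) : yangian :=
  pgenerator (g : pgen yangian_presentation).
Definition J (a : sl2_index) : yangian := ygen (Level0 a).
Definition Jhat (a : sl2_index) : yangian := ygen (Level1 a).
Definition alpha : yangian := ygen Alpha.

Definition counit : {lrmorphism yangian -> C^o} :=
  @plift C yangian_presentation C^o yangian_aug yangian_aug_rel.

Definition yangian2 : algType C := tens2 alpha counit.
Definition tens (x y : yangian) : yangian2 := ptens alpha counit x y.

Definition is_coproduct (Delta : {lrmorphism yangian -> yangian2}) : Prop :=
  [/\ Delta alpha = tens alpha 1,
      forall a, Delta (J a) = tens (J a) 1 + tens 1 (J a),
      Delta (Jhat iH) = tens (Jhat iH) 1 + tens 1 (Jhat iH)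
        - tens alpha 1 * (tens (J (iE true)) (J (iE false))
                          - tens (J (iE false)) (J (iE true)))
    & forall s, Delta (Jhat (iE s)) = tens (Jhat (iE s)) 1 + tens 1 (Jhat (iE s))
        + (pm s / 2%:R) *: (tens alpha 1 * (tens (J (iE s)) (J iH)
                                            - tens (J iH) (J (iE s))))].

Definition is_sl2_involution (theta : {linear 'M[C]_2 -> 'M[C]_2}) : Prop :=
  theta (sl2 iH) = sl2 iH /\ forall s, theta (sl2 (iE s)) = - sl2 (iE s).

(* The inclusion of sl(2) in the Yangian; only used on traceless matrices. *)
Definition level0 (x : 'M[C]_2) : yangian :=
  \sum_(a : sl2_index) \tr (x *m sl2_dual a) *: J a.

Definition is_extended_involution (theta : {linear 'M[C]_2 -> 'M[C]_2})
    (thetabar : {lrmorphism yangian -> yangian}) : Prop :=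
  [/\ involutive thetabar,
      forall x, \tr x = 0 -> thetabar (level0 x) = level0 (theta x),
      thetabar (Jhat iH) = - Jhat iH,
      forall s, thetabar (Jhat (iE s)) = Jhat (iE s)
    & thetabar alpha = - alpha].

Definition subalg_gen (S : set yangian) : set yangian :=
  smallest (fun B : set yangian => GRing.subalg_closed (fun x => x \in B)) S.

(* Delta b lies in the image of Y (x) B in the tensor square. *)
Definition left_coideal (Delta : {lrmorphism yangian -> yangian2})
    (B : set yangian) : Prop :=
  forall b, B b -> exists s : seq (yangian * yangian),
    (forall p, p \in s -> B p.2) /\ Delta b = \sum_(p <- s) tens p.1 p.2.

(* Twisted level-one generators: q runs over the (-1)-eigenvectors and i over
   the fixed vectors of theta in the basis. The linear coefficient is allowed to
   depend on p, because the family treated for sl(2) has coefficients t and - t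
   on E^+ and E^-. *)
Definition twisted_gen (theta : 'M[C]_2 -> 'M[C]_2) (c : sl2_index -> C)
    (p : sl2_index) : yangian :=
  Jhat p + c p *: (alpha * J p)
  + 4%:R^-1 *: (alpha *
      \sum_(q | theta (sl2 q) == - sl2 q) \sum_(i | theta (sl2 i) == sl2 i)
        sl2_struct p q i *: (J q * J i + J i * J q)).

Definition twisted_yangian (theta : 'M[C]_2 -> 'M[C]_2) (c : sl2_index -> C) :
    set yangian :=
  subalg_gen [set x | (exists2 i, theta (sl2 i) = sl2 i & x = J i) \/
    (exists2 p, theta (sl2 p) = - sl2 p & x = twisted_gen theta c p)].

Definition signed_coef (t : C) (p : sl2_index) : C :=
  if p is iE s then pm s * t else t.

Definition Etilde (t : C) (s : bool) : yangian :=
  Jhat (iE s) + (pm s * t) *: (alpha * J (iE s))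
  + (pm s / 4%:R) *: (alpha * (J (iE s) * J iH + J iH * J (iE s))).

End Yangian.

Arguments J {C}.
Arguments Jhat {C}.
Arguments sl2 {C}.

(* Main.v *)
(* On the generators, the coproduct of Etilde^s is Etilde^s (x) 1 + 1 (x) Etilde^s + s alpha E^s (x) H:
   the quadratic correction (s alpha / 4)(E H + H E) contributes
   (s alpha / 2)(E (x) H + H (x) E), which turns the antisymmetric tail
   (s alpha / 2)(E (x) H - H (x) E) of the coproduct of Jhat(E^s) into a term whose right leg is H.
   Both thetabar-invariance and the coideal property are stable under the algebra
   operations, so they pass from generators to the generated subalgebra. *)
Require Import Defs.
From mathcomp Require Import all_boot all_order all_algebra.
From mathcomp Require Import boolp classical_sets reals complex.
Import GRing.Theory.
Local Open Scope ring_scope.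
Local Open Scope classical_set_scope.

(** * Calculus of pure tensors in the balanced tensor square *)

Section TensorSquareTheory.
Context {C : fieldType} {A : algType C} {z : A} {eps : {lrmorphism A -> C^o}}.
Local Notation tp := (tens_presentation z eps).
Local Notation T := (ptens z eps).
Local Notation l x := (pgenerator (inl x : pgen tp)).
Local Notation r x := (pgenerator (inr x : pgen tp)).

Lemma tens_rel_pcls (x y : term C (pgen tp)) :
  tens_rel z x y -> pcls x = pcls y :> tens2 z eps.
Proof. by move=> h; apply/pclsP; apply: cong_rel. Qed.

(** The two copies of the algebra commute, so the right factor [r y] slides past [l x']. *)
Lemma ptens_mulr (x y x' y' : A) : T x y * T x' y' = T (x * x') (y * y').
Proof.
have lM u v : l (u * v) = l u * l v.
  by rewrite /pgenerator pclsM; apply: tens_rel_pcls; constructor.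
have rM u v : r (u * v) = r u * r v.
  by rewrite /pgenerator pclsM; apply: tens_rel_pcls; constructor.
have lr u v : l u * r v = r v * l u.
  by rewrite /pgenerator !pclsM; apply: tens_rel_pcls; constructor.
by rewrite /ptens lM rM -!mulrA; congr (_ * _); rewrite !mulrA lr.
Qed.

Lemma ptens1 : T 1 1 = 1.
Proof.
rewrite /ptens.
have -> : l 1 = 1 by apply: tens_rel_pcls; constructor.
have -> : r 1 = 1 by apply: tens_rel_pcls; constructor.
by rewrite mulr1.
Qed.

Lemma ptens_linearl (y : A) : linear (T^~ y).
Proof.
move=> a x x'; rewrite /ptens.
have -> : l (a *: x + x') = a *: l x + l x'.
  by rewrite /pgenerator pclsZ pclsD; apply: tens_rel_pcls; constructor.
by rewrite mulrDl scalerAl.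
Qed.

Lemma ptens_linearr (x : A) : linear (T x).
Proof.
move=> a y y'; rewrite /ptens.
have -> : r (a *: y + y') = a *: r y + r y'.
  by rewrite /pgenerator pclsZ pclsD; apply: tens_rel_pcls; constructor.
by rewrite mulrDr scalerAr.
Qed.

Lemma ptens_balanced : T 1 z = T z 1.
Proof.
rewrite /ptens.
have -> : l 1 = 1 by apply: tens_rel_pcls; constructor.
have -> : r 1 = 1 by apply: tens_rel_pcls; constructor.
by rewrite mul1r mulr1; apply/esym/tens_rel_pcls; constructor.
Qed.

Lemma ptensDl x x' y : T (x + x') y = T x y + T x' y.
Proof. by have := ptens_linearl y 1 x x'; rewrite !scale1r. Qed.

Lemma ptensDr x y y' : T x (y + y') = T x y + T x y'.
Proof. by have := ptens_linearr x 1 y y'; rewrite !scale1r. Qed.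

Lemma ptens0l y : T 0 y = 0.
Proof. by apply: (addrI (T 0 y)); rewrite -ptensDl !addr0. Qed.

Lemma ptens0r x : T x 0 = 0.
Proof. by apply: (addrI (T x 0)); rewrite -ptensDr !addr0. Qed.

Lemma ptensZl a x y : T (a *: x) y = a *: T x y.
Proof. by have := ptens_linearl y a x 0; rewrite ptens0l !addr0. Qed.

Lemma ptensZr a x y : T x (a *: y) = a *: T x y.
Proof. by have := ptens_linearr x a y 0; rewrite ptens0r !addr0. Qed.

End TensorSquareTheory.

(** * Generated subalgebras and properties inherited from generators *)

Section SubalgGen.
Context {C : fieldType}.
Local Notation Y := (yangian C).
Implicit Types (S B : set Y).

Lemma subalg_gen_sub S : S `<=` subalg_gen S.
Proof. exact: sub_smallest. Qed.

Lemma subalg_gen_closed S :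
  GRing.subalg_closed (fun x : Y => x \in subalg_gen S).
Proof.
split=> [|a u v|u v].
- by apply/mem_set => B [[]] /set_mem.
- move=> /set_mem hu /set_mem hv; apply/mem_set => B [cB sB].
  have [_ h _] := cB.
  by apply/set_mem/h; apply/mem_set; [apply: hu | apply: hv].
- move=> /set_mem hu /set_mem hv; apply/mem_set => B [cB sB].
  have [_ _ h] := cB.
  by apply/set_mem/h; apply/mem_set; [apply: hu | apply: hv].
Qed.

Lemma subalg_gen_min S B :
  GRing.subalg_closed (fun x : Y => x \in B) -> S `<=` B ->
  subalg_gen S `<=` B.
Proof. by move=> cB sB x; apply. Qed.

Lemma fixed_subalg_closed (f : {lrmorphism Y -> Y}) :
  GRing.subalg_closed (fun x => x \in [set x | f x = x]).
Proof.
split=> [|a u v|u v]; first by rewrite inE /= rmorph1.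
- by rewrite !inE /= => hu hv; rewrite linearP /= hu hv.
- by rewrite !inE /= => hu hv; rewrite rmorphM /= hu hv.
Qed.

Section Coideal.
Variable Delta : {lrmorphism Y -> yangian2 C}.

(** Here the element tested is decoupled from the target [B] of the right legs, so that closure can
    be proved with [B] held fixed. *)
Definition coideal_elements B : set Y :=
  [set b | exists s : seq (Y * Y),
    (forall p, p \in s -> B p.2) /\ Delta b = \sum_(p <- s) tens p.1 p.2].

(** [Delta] is an algebra morphism. Scalars are absorbed into left legs, and multiplying two
    expansions termwise multiplies right legs, which stay in the subalgebra [B]. *)
Lemma coideal_elements_closed B :
  GRing.subalg_closed (fun x => x \in B) ->
  GRing.subalg_closed (fun x => x \in coideal_elements B).
Proof.
move=> [B1 _ BM]; split=> [|a u v|u v].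
- rewrite inE; exists [:: (1, 1)]; split.
    by move=> p; rewrite inE => /eqP ->; apply/set_mem.
  by rewrite big_seq1 rmorph1 /tens ptens1.
- rewrite !inE => -[su [Bu hu]] [sv [Bv hv]].
  exists ([seq (a *: p.1, p.2) | p <- su] ++ sv); split.
    by move=> p; rewrite mem_cat => /orP [/mapP [q /Bu Bq ->] //|/Bv].
  rewrite linearP /= hu hv big_cat big_map /= scaler_sumr; congr (_ + _).
  by apply: eq_bigr => p _; rewrite /tens ptensZl.
- rewrite !inE => -[su [Bu hu]] [sv [Bv hv]].
  exists [seq (p.1 * q.1, p.2 * q.2) | p <- su, q <- sv]; split.
    move=> _ /allpairsP [[p q] /= [/Bu Bp /Bv Bq ->]] /=.
    by apply/set_mem/BM; apply/mem_set.
  rewrite rmorphM /= hu hv big_allpairs_dep /= mulr_suml.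
  apply: eq_bigr => p _; rewrite mulr_sumr.
  by apply: eq_bigr => q _; rewrite /tens ptens_mulr.
Qed.

(** The coideal property says that the generated subalgebra lies in its own [coideal_elements]; as
    these form a subalgebra, minimality reduces this to [S]. *)
Lemma left_coideal_gen S :
  S `<=` coideal_elements (subalg_gen S) -> left_coideal Delta (subalg_gen S).
Proof.
move=> hS; apply: subalg_gen_min => //.
exact/coideal_elements_closed/subalg_gen_closed.
Qed.

End Coideal.
End SubalgGen.

(** * Coproduct of the twisted generators *)

Section TwistedYangian.
Context {C : fieldType}.
Hypothesis two_neq0 : 2%:R != 0 :> C.
Local Notation Y := (yangian C).

Let half_double : 2%:R^-1 + 2%:R^-1 = 1 :> C.
Proof. by rewrite -mulr2n -[LHS]mulr_natr mulVf. Qed.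

Let quarter_double : 4%:R^-1 + 4%:R^-1 = 2%:R^-1 :> C.
Proof.
rewrite (natrM _ 2 2) invfM -mulrDr half_double mulr1 //.
Qed.

(** Linear bookkeeping for the coproduct of [Etilde]: indices 1 and 2 mark the left and right leg,
    [e] is the level-one part, [w] is alpha E, [m] and [n] are alpha E H and alpha H E, while [u]
    and [v] are the mixed terms alpha E (x) H and alpha H (x) E. *)
Lemma quarter_sums_collect (V : lmodType C) (p c : C)
    (e1 e2 w1 w2 m1 m2 n1 n2 u v : V) :
  e1 + e2 + (p / 2%:R) *: (u - v) + c *: (w1 + w2)
    + (p / 4%:R) *: (m1 + u + (v + m2) + (n1 + v + (u + n2)))
  = e1 + c *: w1 + (p / 4%:R) *: (m1 + n1)
    + (e2 + c *: w2 + (p / 4%:R) *: (m2 + n2)) + p *: u.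
Proof.
rewrite [X in (p / 4%:R) *: X](AC ((2*2)*(2*2)) ((1*5)*(4*8)*((2*3)*(7*6)))) /=.
(* The half of [u - v] is the tail from level one; the half of [u + v] comes from two quarters, one
   from each order of E and H. *)
have -> : p *: u = (p / 2%:R) *: (u - v) + (p / 2%:R) *: (u + v).
  rewrite -scalerDr addrACA addNr addr0 scalerDr -scalerDl -mulrDr.
  by rewrite half_double mulr1.
rewrite 2![(p / 4%:R) *: (_ + _ + _)]scalerDr [_ *: (u + v + _)]scalerDr.
rewrite -[_ *: (u + v) + _ *: (u + v)]scalerDl -mulrDr quarter_double.
by rewrite [c *: (_ + _)]scalerDr (AC (3*2*3) ((1*4*6)*(2*5*7)*(3*8))).
Qed.

Lemma coproduct_Etilde (Delta : {lrmorphism Y -> yangian2 C}) t s :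
  is_coproduct Delta ->
  Delta (Etilde t s) = tens (Etilde t s) 1 + tens 1 (Etilde t s)
    + pm C s *: tens (alpha C * J (iE s)) (J iH).
Proof.
move=> [Da DJ _ DE].
have DD x y : Delta (x + y) = Delta x + Delta y by rewrite rmorphD.
have DM x y : Delta (x * y) = Delta x * Delta y by rewrite rmorphM.
have DZ a x : Delta (a *: x) = a *: Delta x by rewrite linearZ.
(* Balancing moves every alpha into the left leg, so that both sides are written in the same
   tensors. *)
have bal x : tens 1 (alpha C * x) = tens (alpha C) x.
  by rewrite /tens -[X in ptens _ _ X _](mulr1 1) -ptens_mulr ptens_balanced
     ptens_mulr mulr1 mul1r.
rewrite /Etilde !(DD, DZ, DM) DE Da !DJ /tens !(mulrDl, mulrDr, mulrN).
rewrite !ptens_mulr !(mulr1, mul1r) !(ptensDl, ptensDr, ptensZl, ptensZr).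
rewrite -!/(tens _ _) !bal.
exact: quarter_sums_collect.
Qed.

(** * Matrix computations in sl(2) with the trace form *)

Lemma mxtrace_mul2 (A B : 'M[C]_2) :
  \tr (A *m B) = A 0 0 * B 0 0 + A 0 1 * B 1 0 + (A 1 0 * B 0 1 + A 1 1 * B 1 1).
Proof.
rewrite /mxtrace !big_ord_recl big_ord0 addr0 !mxE !big_ord_recl !big_ord0.
rewrite !addr0.
by have -> : lift ord0 ord0 = 1 :> 'I_2 by apply: val_inj.
Qed.

Lemma big_sl2_index (V : nmodType) (F : sl2_index -> V) :
  \sum_a F a = F iH + (F (iE true) + F (iE false)).
Proof.
rewrite (bigD1 iH) //= (bigD1 (iE true)) //= (bigD1 (iE false)) //=.
by rewrite big_pred0 ?addr0 //; case=> [[]|].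
Qed.

Let simp := (@mulr0 C, @mul0r C, @mulr1 C, @mul1r C, @addr0 C, @add0r C,
  @subr0 C, @sub0r C, @oppr0 C, @mulNr C, @mulrN C, @opprK C).

Lemma tr_sl2_dual a b : \tr (sl2 a *m sl2_dual C b) = (a == b)%:R.
Proof.
rewrite mxtrace_mul2; case: a b => [[]|] [[]|]; rewrite !mxE /= !simp //.
Qed.

Lemma tr_sl2 a : \tr (sl2 a : 'M[C]_2) = 0.
Proof.
rewrite -[sl2 a]mulmx1 mxtrace_mul2.
by case: a => [[]|]; rewrite !mxE /= !simp // subrr.
Qed.

Lemma level0_sl2 a : level0 (sl2 a) = J a :> Y.
Proof.
rewrite /level0 (bigD1 a) //= tr_sl2_dual eqxx scale1r big1 ?addr0 // => b ba.
by rewrite tr_sl2_dual eq_sym (negPf ba) scale0r.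
Qed.

Lemma level0N x : level0 (- x) = - level0 x :> Y.
Proof.
rewrite /level0 -sumrN; apply: eq_bigr => a _.
by rewrite mulNmx linearN scaleNr.
Qed.

(** The dual of E^s' has the opposite sign, hence commutes with E^s unless [s = s']; then the
    bracket is H up to the sign [pm s], and H pairs to 1 with its dual H/2. *)
Lemma sl2_structEH s s' :
  sl2_struct C (iE s) (iE s') iH = if s == s' then pm C s else 0.
Proof.
rewrite /sl2_struct mxtrace_mul2 !mxE !big_ord_recl !big_ord0.
have -> : lift ord0 ord0 = 1 :> 'I_2 by apply: val_inj.
by case: s s' => [] []; rewrite !mxE /= !simp // -opprD half_double.
Qed.

Lemma sl2_decomposition (x : 'M[C]_2) : \tr x = 0 ->
  x = x 0 1 *: sl2 (iE true) + x 1 0 *: sl2 (iE false) + x 0 0 *: sl2 iH.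
Proof.
rewrite -[X in \tr X]mulmx1 mxtrace_mul2 !mxE /= !simp => tr0.
have x11 : x 1 1 = - x 0 0 by apply/eqP; rewrite -addr_eq0 addrC tr0.
apply/matrixP=> i j.
have ord2 (k : 'I_2) : k = 0 \/ k = 1.
  by case: k => [[|[|k]] lt_k2] //; [left | right]; apply: val_inj.
by case: (ord2 i) (ord2 j) => -> [] ->; rewrite !mxE /= !simp.
Qed.

(** Invertibility of 2 keeps the two eigenspaces of [theta] apart. *)
Lemma eq_oppr0 (V : lmodType C) (x : V) : (x == - x) = (x == 0).
Proof.
rewrite -addr_eq0 -mulr2n -scaler_nat scaler_eq0.
by rewrite (negPf two_neq0).
Qed.

Lemma sl2_neq0 a : sl2 a != 0 :> 'M[C]_2.
Proof.
apply/eqP => a0; have := tr_sl2_dual a a.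
by rewrite a0 mul0mx linear0 eqxx => /esym/eqP; rewrite oner_eq0.
Qed.

(** * Eigenspaces of [theta] and the generators they produce *)

Section Involution.
Variable theta : {linear 'M[C]_2 -> 'M[C]_2}.
Hypothesis theta_inv : is_sl2_involution theta.

(** Together with [theta_sl2_anti], this turns the eigenvector conditions in [twisted_gen] and
    [twisted_yangian] into conditions on indices. *)
Lemma theta_sl2_fixed a : (theta (sl2 a) == sl2 a) = (a == iH).
Proof.
have [tH tE] := theta_inv; case: a => [s|]; last by rewrite tH !eqxx.
by rewrite tE eq_sym eq_oppr0 (negPf (sl2_neq0 _)).
Qed.

Lemma theta_sl2_anti a : (theta (sl2 a) == - sl2 a) = (a != iH).
Proof.
have [tH tE] := theta_inv; case: a => [s|]; first by rewrite tE eqxx.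
by rewrite tH eq_oppr0 (negPf (sl2_neq0 _)).
Qed.

Lemma theta_fixed_line x : \tr x = 0 ->
  theta x = x <-> exists a : C, x = a *: sl2 iH.
Proof.
have [tH tE] := theta_inv.
move=> tr0; split=> [fx|[a ->]]; last by rewrite linearZ /= tH.
have xE := sl2_decomposition x tr0.
have theta_xE : theta x = - x 0 1 *: sl2 (iE true) - x 1 0 *: sl2 (iE false)
    + x 0 0 *: sl2 iH.
  have tD y z : theta (y + z) = theta y + theta z by rewrite linearD.
  have tZ a y : theta (a *: y) = a *: theta y by rewrite linearZ.
  by rewrite {1}xE 2!tD !tZ !tE tH !scalerN !scaleNr.
(* [theta] negates the off-diagonal entries, so for a fixed [x] each of them equals its own
   negative. *)
have coef0 i j : theta x i j = - x i j -> x i j = 0.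
  by rewrite fx => /eqP; rewrite (@eq_oppr0 C^o) => /eqP.
have x01 : x 0 1 = 0 by apply: coef0; rewrite theta_xE !mxE /= !simp.
have x10 : x 1 0 = 0 by apply: coef0; rewrite theta_xE !mxE /= !simp.
by exists (x 0 0); rewrite {1}xE x01 x10 !scale0r !add0r.
Qed.

Lemma twisted_gen_sl2 t s :
  twisted_gen theta (signed_coef t) (iE s) = Etilde t s :> Y.
Proof.
rewrite /twisted_gen /Etilde /=; congr (_ + _).
rewrite (eq_bigl (fun q => q != iH)) => [|q]; last exact: theta_sl2_anti.
have sum_fixed (F : sl2_index -> Y) :
    \sum_(i | theta (sl2 i) == sl2 i) F i = F iH.
  by rewrite (eq_bigl (pred1 iH)) ?big_pred1_eq //; apply: theta_sl2_fixed.
(* Only i = H survives in the inner sum, and the structure constant kills the q of sign opposite to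
   [s], leaving [pm s] times the symmetrized product. *)
rewrite big_mkcond big_sl2_index /= add0r !sum_fixed !sl2_structEH.
by case: s => /=; rewrite scale0r ?(addr0, add0r) -scalerAr scalerA
  ![_ / _]mulrC.
Qed.

Lemma twisted_yangian_sl2 t :
  twisted_yangian theta (signed_coef t) =
  subalg_gen [set x : Y | x = J iH \/ exists s, x = Etilde t s].
Proof.
congr subalg_gen; apply/seteqP; split=> x /=.
- case=> [[a /eqP + ->]|[p /eqP + ->]].
    by rewrite theta_sl2_fixed => /eqP ->; left.
  rewrite theta_sl2_anti; case: p => // s _.
  by right; exists s; apply: twisted_gen_sl2.
- case=> [->|[s ->]].
    by left; exists iH => //; apply/eqP; rewrite theta_sl2_fixed.
  right; exists (iE s); last by rewrite twisted_gen_sl2.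
  by apply/eqP; rewrite theta_sl2_anti.
Qed.

(** * Invariance of the generators under [thetabar] *)

Section Extension.
Variable thetabar : {lrmorphism Y -> Y}.
Hypothesis thetabar_ext : is_extended_involution theta thetabar.

Lemma thetabar_H : thetabar (J iH) = J iH.
Proof.
have [_ t0 _ _ _] := thetabar_ext; have [tH _] := theta_inv.
by have := t0 _ (tr_sl2 iH); rewrite tH level0_sl2.
Qed.

(** Each correction term contains alpha once and E once, both negated by [thetabar], and otherwise
    only the fixed H, so the signs cancel. *)
Lemma thetabar_Etilde t s : thetabar (Etilde t s) = Etilde t s.
Proof.
have [_ t0 _ tEh ta] := thetabar_ext; have [_ tE] := theta_inv.
have tJE : thetabar (J (iE s)) = - J (iE s).
  by have := t0 _ (tr_sl2 (iE s)); rewrite tE level0N level0_sl2.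
have tD x y : thetabar (x + y) = thetabar x + thetabar y by rewrite rmorphD.
have tM x y : thetabar (x * y) = thetabar x * thetabar y by rewrite rmorphM.
have tZ a x : thetabar (a *: x) = a *: thetabar x by rewrite linearZ.
rewrite /Etilde !(tD, tZ, tM) tEh ta tJE thetabar_H.
by rewrite mulrN !mulNr mulrN -opprD mulrN !opprK.
Qed.

End Extension.
End Involution.
End TwistedYangian.

Theorem proposition3p2 (R : realType)
    (theta : {linear 'M[R[i]]_2 -> 'M[R[i]]_2})
    (thetabar : {lrmorphism yangian R[i] -> yangian R[i]})
    (Delta : {lrmorphism yangian R[i] -> yangian2 R[i]})
    (htheta : is_sl2_involution theta)
    (hthetabar : is_extended_involution theta thetabar)
    (hDelta : is_coproduct Delta) :
  (forall x : 'M[R[i]]_2, \tr x = 0 ->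
    (theta x = x <-> exists a : R[i], x = a *: sl2 iH)) /\
  forall t : R[i],
    let B := subalg_gen [set x | x = J iH \/ exists s, x = Etilde t s] in
    [/\ twisted_yangian theta (signed_coef t) = B,
        forall b, B b -> thetabar b = b
      & left_coideal Delta B].
Proof.
have two_neq0 : 2%:R != 0 :> R[i] by rewrite Num.Theory.pnatr_eq0.
split=> [x tr0|t B]; first exact: theta_fixed_line.
have genB : [set x | x = J iH \/ exists s, x = Etilde t s] `<=` B.
  exact: subalg_gen_sub.
have [B1 _ _] : GRing.subalg_closed (fun x => x \in B).
  exact: subalg_gen_closed.
split; first exact: twisted_yangian_sl2.
- apply: subalg_gen_min; first exact: fixed_subalg_closed.
  move=> _ [->|[s ->]] /=; first exact: (thetabar_H two_neq0 theta htheta _ hthetabar).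
  exact: (thetabar_Etilde two_neq0 theta htheta _ hthetabar).
- apply: left_coideal_gen => _ [->|[s ->]].
  + exists [:: (J iH, 1); (1, J iH)]; split.
      move=> p; rewrite !inE => /orP[] /eqP -> /=; first exact/set_mem.
      by apply: genB; left.
    by have [_ -> _ _] := hDelta; rewrite big_cons big_seq1.
  (* The third pair carries the extra term of [coproduct_Etilde]: its sign and alpha go to the left
     leg, leaving the generator H on the right. *)
  + exists [:: (Etilde t s, 1); (1, Etilde t s);
              (pm R[i] s *: (alpha R[i] * J (iE s)), J iH)]; split.
      move=> p; rewrite !inE => /or3P[] /eqP -> /=; first exact/set_mem.
        by apply: genB; right; exists s.
      by apply: genB; left.
    rewrite (coproduct_Etilde two_neq0) // !big_cons big_nil addr0 addrA.
    by rewrite /= {6}/tens ptensZl.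
Qed.
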